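(* Let $(X,d)$ be a geodesic metric space with $X$ infinite, such that $|B_{d}(x,1)|=|X|$ for each $x\in X$, where $B_d(x,1)=\{y\in X:d(x,y)\le 1\}$. Then the coarse structure $\mathcal{E}_{d}$ is $\vee$-decomposable.
   Context: A metric space $(X,d)$ is geodesic if, for any $x,y\in X$, there is an isometric embedding $f:[0,d(x,y)]\to X$ such that $f(0)=x$ and $f(d(x,y))=y$. A coarse structure on a set $X$ is a family $\mathcal{E}$ of subsets of $X\times X$ such that: each $\varepsilon\in\mathcal{E}$ contains the diagonal $\Delta_X=\{(x,x):x\in X\}$; if $\varepsilon,\delta\in\mathcal{E}$ then $\varepsilon\circ\delta=\{(x,y):\exists z\,((x,z)\in\varepsilon,(z,y)\in\delta)\}\in\mathcal{E}$ and $\varepsilon^{-1}=\{(y,x):(x,y)\in\varepsilon\}\in\mathcal{E}$; if $\varepsilon\in\mathcal{E}$ and $\Delta_X\subseteq\varepsilon'\subseteq\varepsilon$ then $\varepsilon'\in\mathcal{E}$. Only connected coarse structures on infinite sets are considered: for any $x,y\in X$ there is $\varepsilon\in\mathcal{E}$ with $(x,y)\in\varepsilon$. A subset $\mathcal{E}'\subseteq\mathcal{E}$ is a base of $\mathcal{E}$ if every $\varepsilon\in\mathcal{E}$ is contained in some $\varepsilon'\in\mathcal{E}'$. $\mathcal{E}_0\vee\mathcal{E}_1$ is the smallest (by inclusion) coarse structure on $X$ containing both $\mathcal{E}_0$ and $\mathcal{E}_1$. A coarse structure is cellular if it has a base consisting of equivalence relations. A coarse structure $\mathcal{E}$ on $X$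 is $\vee$-decomposable if there exist two cellular coarse structures $\mathcal{E}_0,\mathcal{E}_1$ on $X$ with $\mathcal{E}=\mathcal{E}_0\vee\mathcal{E}_1$. For a metric $d$ on $X$, $\mathcal{E}_d$ is the coarse structure with base $\{(x,y)\in X\times X:d(x,y)\le n\}$, $n\in\omega$. *)

(* Defs.v *)
From HB Require Import structures.
From Corelib Require Import RelationClasses.
From mathcomp Require Import all_boot all_order all_algebra.
From mathcomp Require Import boolp classical_sets functions cardinality reals.
From mathcomp Require Import topology.

Set Implicit Arguments.
Unset Strict Implicit.
Unset Printing Implicit Defensive.

Import Order.TTheory GRing.Theory Num.Theory.

Local Open Scope classical_set_scope.
Local Open Scope ring_scope.

(* [f] is a total function whose values outside [0, d(x, y)] are irrelevant. *)
Definition geodesic (R : realType) (X : metricType R) : Prop :=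
  forall x y : X, exists f : R -> X,
    [/\ f 0 = x,
        f (mdist x y) = y &
        forall s t : R, 0 <= s <= mdist x y -> 0 <= t <= mdist x y ->
          mdist (f s) (f t) = `|s - t|].

(* Coarse structures are connected by convention, hence the last field.  In
   [coarse_comp], [B \; A] relates x to y when (x, z) is in A and (z, y) is in B
   for some z, so [d \; e] is the composite of e and d written with e first. *)
Record coarse_structure (X : Type) (E : set (set (X * X))) : Prop :=
  CoarseStructure {
    coarse_diag : forall e, E e -> diagonal `<=` e;
    coarse_comp : forall e d, E e -> E d -> E (d \; e)%relation;
    coarse_inv : forall e, E e -> E (e^-1)%relation;
    coarse_sub : forall e e', E e -> diagonal `<=` e' -> e' `<=` e -> E e';
    coarse_conn : forall x y : X, exists2 e, E e & e (x, y)
  }.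

Definition coarse_base (X : Type) (B E : set (set (X * X))) : Prop :=
  B `<=` E /\ forall e, E e -> exists2 b, B b & e `<=` b.

(* The only coarse structure that can have [B] as a base, see
   [coarse_of_baseP]. *)
Definition coarse_of_base (X : Type) (B : set (set (X * X))) :
    set (set (X * X)) :=
  [set e | diagonal `<=` e /\ exists2 b, B b & e `<=` b].

Definition coarse_join (X : Type) (E0 E1 : set (set (X * X))) :
    set (set (X * X)) :=
  smallest (@coarse_structure X) (E0 `|` E1).

Definition cellular (X : Type) (E : set (set (X * X))) : Prop :=
  coarse_structure E /\
  exists2 B, coarse_base B E &
    forall b, B b -> Equivalence (fun x y : X => b (x, y)).

Definition vee_decomposable (X : Type) (E : set (set (X * X))) : Prop :=
  exists E0 E1 : set (set (X * X)),
    [/\ cellular E0, cellular E1 & E = coarse_join E0 E1].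

Definition metric_coarse (R : realType) (X : metricType R) :
    set (set (X * X)) :=
  coarse_of_base [set [set xy | mdist xy.1 xy.2 <= n%:R] | n in [set: nat]].
Arguments metric_coarse {R} X _.

Lemma coarse_of_baseP (X : Type) (B E : set (set (X * X))) :
  coarse_structure E -> coarse_base B E -> E = coarse_of_base B.
Proof.
move=> cE [BE EB]; apply/seteqP; split => e.
  by move=> Ee; split; [exact: (coarse_diag cE)|exact: EB].
by move=> [De [b Bb eb]]; exact: (coarse_sub cE (BE _ Bb)).
Qed.

Lemma coarse_join_structure (X : Type) (E0 E1 : set (set (X * X))) :
  coarse_structure E0 -> coarse_structure E1 ->
  coarse_structure (coarse_join E0 E1).
Proof.
move=> cE0 cE1; split.
- have cT : coarse_structure [set e : set (X * X) | diagonal `<=` e].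
    split => //=.
    + by move=> e d De Dd [x y] /diagonalP ->; exists y; [exact: De|exact: Dd].
    + by move=> e De [x y] /diagonalP ->; exact: De.
    + by move=> x y; exists setT.
  move=> e; apply: (smallest_sub cT) => d [|].
    exact: (coarse_diag cE0).
  exact: (coarse_diag cE1).
- by move=> e d Ee Ed M [cM EM]; apply: (coarse_comp cM); [apply: Ee|apply: Ed].
- by move=> e Ee M [cM EM]; apply: (coarse_inv cM); apply: Ee.
- by move=> e e' Ee De' e'e M [cM EM]; apply: (coarse_sub cM _ De' e'e); apply: Ee.
- move=> x y; have [e Ee exy] := coarse_conn cE0 x y.
  by exists e => // M [_]; apply; left.
Qed.

Lemma metric_coarse_structure (R : realType) (X : metricType R) :
  coarse_structure (metric_coarse X).
Proof.
have dD (n : nat) : diagonal `<=` [set xy : X * X | mdist xy.1 xy.2 <= n%:R].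
  by move=> [x y] /diagonalP ->; rewrite /= mdistxx.
split.
- by move=> e [].
- move=> e d [De [_ [m _ <-] em]] [Dd [_ [n _ <-] dn]]; split.
    by move=> [x y] /diagonalP ->; exists y; [exact: De|exact: Dd].
  exists [set xy : X * X | mdist xy.1 xy.2 <= (m + n)%:R]; first by exists (m + n)%N.
  move=> [x y] /= [z /em /= xz /dn /= zy].
  by rewrite natrD (le_trans (metric_triangle _ z _))// lerD.
- move=> e [De [_ [m _ <-] em]]; split; first by move=> [x y] /diagonalP ->; exact: De.
  exists [set xy : X * X | mdist xy.1 xy.2 <= m%:R]; first by exists m.
  by move=> [x y] /= /em /=; rewrite metric_sym.
- move=> e e' [De [b Bb eb]] De' e'e; split=> //; exists b => //.
  exact: subset_trans eb.
- move=> x y; have [n xyn] : exists n : nat, mdist x y <= n%:R.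
    by exists (Num.truncn (mdist x y)).+1; rewrite ltW// truncnS_gt.
  exists [set xy : X * X | mdist xy.1 xy.2 <= n%:R] => //.
  by split; [exact: dD|exists [set xy : X * X | mdist xy.1 xy.2 <= n%:R] => //; exists n].
Qed.

Lemma metric_coarse_base (R : realType) (X : metricType R) :
  coarse_base [set [set xy | mdist xy.1 xy.2 <= n%:R] | n in [set: nat]]
    (metric_coarse X).
Proof.
split=> [_ [n _ <-]|e []//]; split; first by move=> [x y] /diagonalP ->; rewrite /= mdistxx.
by exists [set xy : X * X | mdist xy.1 xy.2 <= n%:R] => //; exists n.
Qed.

(* Main.v *)
(** Fix a maximal set N of centers whose closed unit balls are pairwise
    disjoint, and send every point to a center p x within distance 2, with
    p x = a as soon as x lies in the unit ball of a.  The fibres of p form a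
    uniformly bounded partition whose cells contain the unit balls of the
    centers, hence have the cardinality of X.  There is therefore room for a
    matching that joins, for any two centers a, b within distance 5, a point of
    the cell of a to one of the cell of b.  Two points at distance at most 1 are
    then linked by cell, matching, cell; by geodesicity this controls all
    distances.  Each of the two equivalence relations generates a connected
    cellular structure once its classes meeting the ball of radius n around a
    base point are merged, for every n. *)

Require Import Defs.
From Corelib Require Import RelationClasses.
From mathcomp Require Import all_boot all_order all_algebra.
From mathcomp Require Import boolp classical_sets functions cardinality reals.
From mathcomp Require Import topology.
From mathcomp Require Import lra.

Set Implicit Arguments.
Unset Strict Implicit.
Unset Printing Implicit Defensive.

Import Order.TTheory GRing.Theory Num.Theory.

Local Open Scope classical_set_scope.
Local Open Scope ring_scope.
Local Open Scope card_scope.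

Definition set_equivalence (X : Type) (e : set (X * X)) : Prop :=
  Equivalence (fun x y : X => e (x, y)).

(** Two members of the chain lie in the later one, whose transitivity absorbs their composite;
    covering all pairs gives connectedness. *)
Lemma cellular_of_chain (X : Type) (b : nat -> set (X * X)) :
  (forall n, set_equivalence (b n)) ->
  (forall m n, (m <= n)%N -> b m `<=` b n) ->
  (forall x y, exists n, b n (x, y)) ->
  cellular (coarse_of_base (range b)).
Proof.
move=> eqb leb covb.
have bxx n : diagonal `<=` b n.
  by move=> [x y] /diagonalP ->; exact: (@Equivalence_Reflexive _ _ (eqb n)).
have Eb n : coarse_of_base (range b) (b n).
  by split; [exact: bxx|exists (b n) => //; exists n].
split; last first.
  exists (range b); last by move=> _ [n _ <-]; exact: eqb.
  by split=> [_ [n _ <-]|e []//]; exact: Eb.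
split.
- by move=> e [].
- move=> e d [De [_ [m _ <-] em]] [Dd [_ [n _ <-] dn]]; split.
    by move=> [x y] /diagonalP ->; exists y; [exact: De|exact: Dd].
  exists (b (maxn m n)); first by exists (maxn m n).
  move=> [x y] [z /= /em xz /dn zy].
  apply: (@Equivalence_Transitive _ _ (eqb (maxn m n)) x z y).
    exact: leb (leq_maxl m n) _ xz.
  exact: leb (leq_maxr m n) _ zy.
- move=> e [De [_ [m _ <-] em]]; split.
    by move=> [x y] /diagonalP ->; exact: De.
  exists (b m); first by exists m.
  by move=> [x y] /= /em; exact: (@Equivalence_Symmetric _ _ (eqb m)).
- move=> e e' [De [c Bc ec]] De' e'e; split=> //; exists c => //.
  exact: subset_trans ec.
- by move=> x y; have [n bxy] := covb x y; exists (b n).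
Qed.

Definition merge (X : Type) (e : set (X * X)) (A : set X) : set (X * X) :=
  e `|` [set xy | (exists2 z, A z & e (z, xy.1)) /\
                  (exists2 z, A z & e (z, xy.2))].

Lemma merge_equivalence (X : Type) (e : set (X * X)) (A : set X) :
  set_equivalence e -> set_equivalence (merge e A).
Proof.
move=> [exx exy exyz]; split.
- by move=> x; left; exact: exx.
- by move=> x y [/exy|[Sx Sy]]; [left|right].
- have sat x y : (exists2 z, A z & e (z, x)) -> e (x, y) ->
      exists2 z, A z & e (z, y).
    by move=> [z Az zx] xy; exists z => //; exact: exyz zx xy.
  move=> x y z [xy|[Sx Sy]] [yz|[Sy' Sz]].
  + by left; exact: exyz xy yz.
  + by right; split=> //=; apply: (sat y) => //; exact: exy.
  + by right; split=> //=; exact: (sat y).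
  + by right.
Qed.

Section metric.
Variables (R : realType) (X : metricType R).
Implicit Types (x y z : X) (e : set (X * X)).

Definition entourage_le (r : R) : set (X * X) :=
  [set xy | mdist xy.1 xy.2 <= r].

Lemma metric_coarse_entourage e (r : R) :
  diagonal `<=` e -> e `<=` entourage_le r -> metric_coarse X e.
Proof.
move=> De er; split=> //.
exists (entourage_le (Num.truncn r).+1%:R); first by exists (Num.truncn r).+1.
move=> xy /er /= /le_trans; apply.
by rewrite ltW// truncnS_gt.
Qed.

Lemma cellular_bounded_equivalence e (r : R) (x0 : X) :
  set_equivalence e -> e `<=` entourage_le r ->
  exists E, [/\ cellular E, E e & E `<=` metric_coarse X].
Proof.
move=> eqe er.
pose B n : set X := [set z | mdist x0 z <= n%:R].
have exx : diagonal `<=` e.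
  by move=> [x y] /diagonalP ->; exact: (@Equivalence_Reflexive _ _ eqe).
exists (coarse_of_base (range (fun n => merge e (B n)))); split.
- apply: cellular_of_chain => [n|m n mn|x y].
  + exact: merge_equivalence.
  + move=> [x y] [xy|[[z Bz zx] [t Bt ty]]]; [by left|right].
    have leB u : B m u -> B n u by move=> /le_trans; apply; rewrite ler_nat.
    by split; [exists z|exists t] => //; exact: leB.
  + have lt_nat (s : R) : s <= (Num.truncn s).+1%:R by rewrite ltW// truncnS_gt.
    pose s := Num.max (mdist x0 x) (mdist x0 y).
    exists (Num.truncn s).+1; right; split.
      exists x; last exact: exx.
      by apply: le_trans (lt_nat s); rewrite /s le_max lexx.
    exists y; last exact: exx.
    by apply: le_trans (lt_nat s); rewrite /s le_max lexx orbT.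
- split=> //; exists (merge e (B 0%N)); first by exists 0%N.
  by move=> xy; left.
- move=> f [Df [_ [n _ <-] fn]].
  (* The sum bounds the path [x], [z], [x0], [t], [y] through the base point; [r] covers the pairs
     already in [e]. *)
  apply: (@metric_coarse_entourage _ (Num.max r (r + n%:R + n%:R + r))) => //.
  move=> [x y] /fn [/er /= xy|/= [[z Bz /er/= zx] [t Bt /er/= ty]]].
    by rewrite /entourage_le/= le_max xy.
  rewrite /entourage_le/= le_max; apply/orP; right.
  move: Bz Bt zx ty; rewrite /B/entourage_le/= => Bz Bt zx ty.
  have := metric_triangle x z y; have := metric_triangle z x0 y.
  have := metric_triangle x0 t y; rewrite (metric_sym x z) (metric_sym z x0).
  lra.
Qed.

Lemma coarse_structure_geodesic (M : set (set (X * X))) :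
  geodesic X -> coarse_structure M -> M (entourage_le 1) ->
  metric_coarse X `<=` M.
Proof.
move=> hgeo cM M1.
have entxx r : 0 <= r -> diagonal `<=` entourage_le r.
  by move=> r0 [x y] /diagonalP ->; rewrite /entourage_le/= mdistxx.
have Mn n : M (entourage_le n%:R).
  elim: n => [|n IH].
    apply: (coarse_sub cM M1); first exact: entxx.
    by move=> xy /= /le_trans; apply.
  apply: (coarse_sub cM (coarse_comp cM IH M1)); first exact: entxx.
  move=> [x y]; rewrite /entourage_le/= => xy.
  have [f [f0 fd fE]] := hgeo x y.
  have d0 : 0 <= mdist x y by exact: mdist_ge0.
  have n0 : 0 <= n%:R :> R by [].
  move: xy; rewrite -natr1 => xy.
  have [nd|dn] := leP n%:R (mdist x y).
    (* The geodesic point at parameter [n] is at distance [n] from [x], hence at most 1 from [y]. *)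
    exists (f n%:R) => /=.
      have := fE 0 n%:R; rewrite f0 sub0r normrN ger0_norm// lexx d0 n0 nd.
      by move=> ->.
    have := fE n%:R (mdist x y); rewrite fd distrC ger0_norm ?subr_ge0//.
    rewrite lexx d0 n0 nd => ->//.
    lra.
  by exists y => /=; [exact: ltW|rewrite mdistxx].
by move=> e [De [_ [n _ <-] en]]; exact: (coarse_sub cM (Mn n)).
Qed.

Lemma vee_decomposable_equivalences (e0 e1 : set (X * X)) (r : R) (x0 : X) :
  geodesic X ->
  set_equivalence e0 -> e0 `<=` entourage_le r ->
  set_equivalence e1 -> e1 `<=` entourage_le r ->
  entourage_le 1 `<=` (e0 \; (e1 \; e0))%relation ->
  vee_decomposable (metric_coarse X).
Proof.
move=> hgeo eq0 e0r eq1 e1r sub1.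
have [E0 [cE0 E0e E0d]] := cellular_bounded_equivalence x0 eq0 e0r.
have [E1 [cE1 E1e E1d]] := cellular_bounded_equivalence x0 eq1 e1r.
exists E0, E1; split=> //; apply/seteqP; split.
  (* Any [M] containing both structures contains the composite of [e0], [e1], [e0], hence the unit
     entourage, which generates the rest along geodesics. *)
  move=> e de M [cM EM].
  have M0 : M e0 by apply: EM; left.
  have M1 : M e1 by apply: EM; right.
  apply: (coarse_structure_geodesic hgeo cM) de.
  apply: (coarse_sub cM _ _ sub1).
    by apply: (coarse_comp cM) => //; exact: (coarse_comp cM).
  by move=> [x y] /diagonalP ->; rewrite /entourage_le/= mdistxx.
by apply: smallest_sub; [exact: metric_coarse_structure|rewrite subUset].
Qed.

Lemma separated_projection :
  exists (N : set X) (p : X -> X), forall x,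
    [/\ N (p x), mdist x (p x) <= 2 &
        forall a, N a -> mdist a x <= 1 -> p x = a].
Proof.
pose B a : set X := [set x | mdist a x <= 1].
have [N [_ tN maxN]] := ex_maximal_disjoint_subcollection B setT.
exists N; suff /choice[p pP] : forall x, exists a,
    [/\ N a, mdist x a <= 2 & forall b, N b -> mdist b x <= 1 -> a = b].
  by exists p.
move=> x; have [[a Na ax]|far] := EM (exists2 a, N a & mdist a x <= 1).
  exists a; split=> //; first by rewrite metric_sym; lra.
  by move=> b Nb bx; apply: tN => //; exists x.
have Nx : ~ N x by move=> Nx; apply: far; exists x => //; rewrite mdistxx.
(* Otherwise [x] could be added to [N], against maximality. A common point [z] of the two unit balls
   then gives the distance 2. *)
have [a Na [z [az xz]]] : exists2 a, N a & B a `&` B x !=set0.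
  apply: contrapT => far2; apply: (maxN (N `|` [set x])) => //.
    by split; [exact: subsetUl|move=> /(_ x); apply: contra_not Nx; apply; right].
  move=> i j [Ni|->] [Nj|->] //; first exact: tN.
    by move=> ij; case: far2; exists i.
  by rewrite setIC => ij; case: far2; exists j.
exists a; split=> //; last by move=> b Nb bx; case: far; exists b.
move: az xz; rewrite /B/= => az xz; have := metric_triangle x z a.
by rewrite (metric_sym z a); lra.
Qed.

(** Provides the room for the matching: [g a b] is a point near [a] reserved for the partner [b],
    and distinct partners get distinct points. *)
Lemma ball_injection :
  (forall x : X, [set y : X | mdist x y <= 1] #= [set: X]) ->
  exists g : X -> X -> X,
    forall a, injective (g a) /\ forall x, mdist a (g a x) <= 1.
Proof.
move=> hball; suff /choice[g gP] : forall a, exists h : X -> X,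
    injective h /\ forall x, mdist a (h x) <= 1 by exists g.
move=> a; have /card_esym/card_bijP[f /bij_inj finj] := hball a.
exists (fun x => val (f (SigSub (mem_set (I : [set: X] x))))); split.
  by move=> x y /val_inj/finj/(congr1 val).
by move=> x; have := valP (f (SigSub (mem_set (I : [set: X] x)))); rewrite inE.
Qed.

End metric.

Theorem proposition12 (R : realType) (X : metricType R)
    (hgeo : geodesic X)
    (hinf : infinite_set [set: X])
    (hball : forall x : X, [set y : X | mdist x y <= 1] #= [set: X]) :
  vee_decomposable (metric_coarse X).
Proof.
have [x0 _] := infinite_setN0 hinf.
have [N [p pP]] := separated_projection X.
have [g gP] := ball_injection hball.
have gK a b : N a -> p (g a b) = a.
  by move=> Na; have [_ _] := pP (g a b); apply=> //; exact: (gP a).2.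
pose e0 : set (X * X) := [set xy | p xy.1 = p xy.2].
(* The bound 5 is 2 + 1 + 2: the distance between the centers of two points at distance at most
   1. *)
pose matched : set (X * X) := [set xy | exists a b,
  [/\ N a, N b, mdist a b <= 5, xy.1 = g a b & xy.2 = g b a]].
pose e1 : set (X * X) := diagonal `|` matched.
(* Cells have diameter at most 2 + 2, and matched points are within 1 + 5 + 1. *)
apply: (@vee_decomposable_equivalences _ _ e0 e1 7 x0) => //.
- by split=> [x|x y|x y z]; rewrite /e0/= => // -> ->.
- move=> [x y]; rewrite /e0/entourage_le/= => xy.
  have [_ xp _] := pP x; have [_ yp _] := pP y.
  have := metric_triangle x (p x) y; rewrite {2}xy (metric_sym (p y)).
  lra.
- have msym x y : matched (x, y) -> matched (y, x).
    move=> [a [b [Na Nb ab xE yE]]]; exists b, a.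
    by split=> //; rewrite metric_sym.
  split=> [x|x y|x y z]; first by left; apply/diagonalP.
    by move=> [/diagonalP ->|/msym ?]; [left; apply/diagonalP|right].
  move=> [/diagonalP ->//|xy] [/diagonalP <-|yz]; first by right.
  (* From the middle point [g b a], [p] recovers [b] and injectivity of [g b] recovers [a]. So each
     point has at most one partner, and two matched steps lead back to the start. *)
  left; apply/diagonalP.
  have [a [b [Na Nb _ /= -> yE]]] := xy.
  have [b' [a' [Nb' Na' _ /= yE' ->]]] := yz.
  have bb' : b = b' by rewrite -(gK b a Nb) -(gK b' a' Nb') -yE -yE'.
  rewrite -{}bb' in yE' *; congr (g _ b).
  by apply: (gP b).1; rewrite -[LHS]yE.
- move=> [x y] [/diagonalP ->|]; first by rewrite /entourage_le/= mdistxx.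
  move=> [a [b [_ _ ab /= -> ->]]]; rewrite /entourage_le/=.
  have := metric_triangle (g a b) a (g b a); have := metric_triangle a b (g b a).
  have := (gP a).2 b; have := (gP b).2 a; rewrite (metric_sym (g a b) a).
  lra.
- move=> [x y]; rewrite /entourage_le/= => xy.
  have [Nx xp _] := pP x; have [Ny yp _] := pP y.
  (* The chain is [x], [g (p x) (p y)], [g (p y) (p x)], [y]; the outer composite is split first, so
     the point in the cell of [y] is given first. *)
  exists (g (p y) (p x)) => /=; last by rewrite /e0/= gK.
  exists (g (p x) (p y)) => /=; first by rewrite /e0/= gK.
  right; exists (p x), (p y); split=> //.
  have := metric_triangle (p x) x (p y); have := metric_triangle x y (p y).
  by rewrite (metric_sym (p x) x); lra.
Qed.
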